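(* Let $E$ be a row-finite directed graph. Let $\phi : C^*_{\min}(E) \to B$ be a homomorphism into a $C^*$-algebra $B$. Then $\phi$ is injective if and only if $\phi(p^m_v) \neq 0$ for all $v \in E^0$.
   Context: A directed graph $E$ consists of countable sets $E^0$ (vertices) and $E^1$ (edges) and maps $r,s : E^1 \to E^0$; the edge $e$ points from $s(e)$ to $r(e)$. Write $vE^1 = r^{-1}(v)$. $E$ is row-finite if $vE^1$ is finite for every $v \in E^0$. A path is a sequence $\lambda = \lambda_1 \cdots \lambda_n$ of edges with $s(\lambda_i) = r(\lambda_{i+1})$ for $i<n$; $r(\lambda) = r(\lambda_1)$, $s(\lambda) = s(\lambda_n)$, $|\lambda| = n$ (vertices are paths of length $0$). For elements $t_e$ indexed by edges, $t_\lambda := t_{\lambda_1}\cdots t_{\lambda_n}$. A cycle is a path $\mu = \mu_1 \cdots \mu_{|\mu|}$ with $|\mu| \ge 1$, $r(\mu) = s(\mu)$ and $s(\mu_i) \ne s(\mu_j)$ for $i<j$. It has no entrance in $E$ if $e \in E^1$ and $r(e) = r(\mu_i)$ imply $e = \mu_i$, for all $i$. For a cycle $\mu$, $[\mu]$ is the set of its cyclic permutations and $[\mu]^1 = \{\mu_i : 1 \le i \le |\mu|\}$. $C(E)$ is the set of all $[\mu]$ where $\mu$ is a cycle with no entrance in $E$, and $C(E)^1 = \bigcup_{C \in C(E)} C^1$. A cutting set for $E$ is a subset $X \subset C(E)^1$ such that $X \cap C^1$ is a singleton for each $C \in C(E)$. A Toeplitz-Cuntz-Krieger $E$-family in a $C^*$-algebra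 consists of elements $\{p_v : v \in E^0\}$, $\{s_e : e \in E^1\}$ such that (T1) the $p_v$ are mutually orthogonal projections; (T2) $s_e^* s_e = p_{s(e)}$ for all $e \in E^1$; (T3) $p_v \ge \sum_{e \in F} s_e s_e^*$ for all $v \in E^0$ and finite $F \subset r^{-1}(v)$. It is a Cuntz-Krieger $E$-family if moreover (CK) $p_v = \sum_{r(e)=v} s_e s_e^*$ whenever $0 < |r^{-1}(v)| < \infty$. A normalised reduced Cuntz-Krieger $E$-family is a Cuntz-Krieger $E$-family such that $s_\mu = p_{r(\mu)}$ for each cycle $\mu$ with no entrance in $E$. $C^*_{\min}(E)$ denotes the co-universal $C^*$-algebra of $E$ (existing for row-finite $E$, and unique up to isomorphism): it is generated by a normalised reduced Cuntz-Krieger $E$-family $\{p^m_v : v \in E^0\}$, $\{s^m_e : e \in E^1\}$ such that (a) every $p^m_v$ is nonzero; (b) given any Toeplitz-Cuntz-Krieger $E$-family $\{q_v\}, \{t_e\}$ in a $C^*$-algebra with each $q_v \ne 0$ and any cutting set $X$ for $E$, there are a function $\kappa : X \to \mathbb{T}$ and a homomorphism $\psi_{q,t} : C^*(\{q_v, t_e : v \in E^0, e \in E^1\}) \to C^*_{\min}(E)$ with $\psi_{q,t}(q_v) = p^m_v$ for all $v \in E^0$, $\psi_{q,t}(t_e) = s^m_e$ for all $e \in E^1 \setminus X$, and $\psi_{q,t}(t_x) = \kappa(x) s^m_x$ for all $x \in X$. *)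

(* Defs.v *)
From HB Require Import structures.
From mathcomp Require Import all_boot all_order all_algebra.
From mathcomp Require Import all_classical all_reals all_analysis.
From mathcomp Require Import complex.

Set Implicit Arguments.
Unset Strict Implicit.
Unset Printing Implicit Defensive.

Import Order.TTheory GRing.Theory Num.Theory.
Import numFieldNormedType.Exports.

Local Open Scope classical_set_scope.
Local Open Scope ring_scope.

Reserved Notation "x ** y" (at level 40, left associativity).

(* C*-algebras need not be unital, so the product cannot be the one of
   MathComp's (unital) algebra structures.  As for every normed module over
   [R[i]], norms are elements of [R[i]]. *)
HB.mixin Record isCStarAlgebra (R : realType) A
    of CompleteNormedModule R[i] A := {
  amul : A -> A -> A;
  adj : A -> A;
  amulA : associative amul;
  amulDl : left_distributive amul +%R;
  amulDr : right_distributive amul +%R;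
  amulZl : forall (c : R[i]) x y, amul (c *: x) y = c *: amul x y;
  amulZr : forall (c : R[i]) x y, amul x (c *: y) = c *: amul x y;
  adjK : involutive adj;
  adjD : {morph adj : x y / x + y};
  adjZ : forall (c : R[i]) x, adj (c *: x) = Num.conj c *: adj x;
  adjM : forall x y, adj (amul x y) = amul (adj y) (adj x);
  norm_amul : forall x y, `|amul x y| <= `|x| * `|y| ;
  norm_cstar : forall x, `|amul (adj x) x| = `|x| ^+ 2
}.

#[short(type="cstarAlgType")]
HB.structure Definition CStarAlgebra (R : realType) :=
  {A of isCStarAlgebra R A & CompleteNormedModule R[i] A}.

Notation "x ** y" := (amul x y) : ring_scope.

Section CStarAlgebraNotions.
Context {R : realType}.
Implicit Types A B : cstarAlgType R.

Definition projection A (x : A) : Prop := adj x = x /\ x ** x = x.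

(* The order of a C*-algebra: [cle x y] means that [y - x] is positive. *)
Definition cle A (x y : A) : Prop := exists z : A, y - x = adj z ** z.

Record cstar_subalgebra A (S : set A) : Prop := {
  csub0 : S 0;
  csubD : forall x y, S x -> S y -> S (x + y);
  csubZ : forall (c : R[i]) x, S x -> S (c *: x);
  csubM : forall x y, S x -> S y -> S (x ** y);
  csub_adj : forall x, S x -> S (adj x);
  csub_closed : closed S
}.

Definition cstar_gen A (G : set A) : set A := smallest (@cstar_subalgebra A) G.

(* [f] restricts to a *-homomorphism on the C*-subalgebra [S]; its values
   outside [S] are irrelevant. *)
Record star_hom_on A B (S : set A) (f : A -> B) : Prop := {
  homD : forall x y, S x -> S y -> f (x + y) = f x + f y;
  homZ : forall (c : R[i]) x, S x -> f (c *: x) = c *: f x;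
  homM : forall x y, S x -> S y -> f (x ** y) = f x ** f y;
  hom_adj : forall x, S x -> f (adj x) = adj (f x)
}.

Definition star_hom A B (f : A -> B) : Prop := star_hom_on setT f.

End CStarAlgebraNotions.

(* The edge [e] points from [src e] to [rng e]. *)
Record digraph := Digraph {
  vertex : countType;
  edge : countType;
  rng : edge -> vertex;
  src : edge -> vertex
}.

Section GraphNotions.
Variable E : digraph.
Implicit Types (v : vertex E) (e f : edge E) (mu : seq (edge E)).

Definition in_edges v : set (edge E) := [set e | rng e = v].

Definition row_finite : Prop := forall v, finite_set (in_edges v).

Definition composable e f : bool := src e == rng f.

(* The path [mu_1 ... mu_n] is the sequence [:: mu_1; ...; mu_n]. *)
Definition is_cycle mu : bool :=
  if mu is e :: mu' then
    [&& path composable e mu', rng e == src (last e mu')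
      & uniq [seq src f | f <- mu]]
  else false.

Definition no_entrance mu : Prop :=
  forall f, f \in mu -> forall e, rng e = rng f -> e = f.

Definition cycle_class mu : set (seq (edge E)) :=
  [set nu | exists k, nu = rot k mu].

Definition class_edges (C : set (seq (edge E))) : set (edge E) :=
  [set e | exists2 mu, C mu & e \in mu].

Definition entry_free_classes : set (set (seq (edge E))) :=
  [set C | exists mu, [/\ is_cycle mu, no_entrance mu & C = cycle_class mu]].

Definition cutting_set (X : set (edge E)) : Prop :=
  X `<=` \bigcup_(C in entry_free_classes) class_edges C /\
  forall C, entry_free_classes C -> exists x, X `&` class_edges C = [set x].

End GraphNotions.

Section Families.
Context {R : realType} (E : digraph).
Implicit Types A B : cstarAlgType R.

Record toeplitz_CK_family A (p : vertex E -> A) (s : edge E -> A) : Prop := {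
  TCK_proj : forall v, projection (p v);
  TCK_orth : forall v w, v <> w -> p v ** p w = 0;
  TCK_src : forall e, adj (s e) ** s e = p (src e);
  TCK_rng : forall v (F : set (edge E)), finite_set F -> F `<=` in_edges v ->
    cle (\sum_(e \in F) s e ** adj (s e)) (p v)
}.

Definition CK_family A (p : vertex E -> A) (s : edge E -> A) : Prop :=
  toeplitz_CK_family p s /\
  forall v, in_edges v !=set0 -> finite_set (in_edges v) ->
    p v = \sum_(e \in in_edges v) s e ** adj (s e).

(* The element indexed by the path [e :: mu]. *)
Definition path_elt A (s : edge E -> A) (e : edge E) (mu : seq (edge E)) : A :=
  foldl (fun x f => x ** s f) (s e) mu.

Definition normalised_reduced_CK_family A
    (p : vertex E -> A) (s : edge E -> A) : Prop :=
  CK_family p s /\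
  forall e mu, is_cycle (e :: mu) -> no_entrance (e :: mu) ->
    path_elt s e mu = p (rng e).

Definition family_set A (p : vertex E -> A) (s : edge E -> A) : set A :=
  range p `|` range s.

(* [A], with the family [p], [s], is the co-universal C*-algebra of [E]. *)
Record is_Cmin A (p : vertex E -> A) (s : edge E -> A) : Prop := {
  Cmin_family : normalised_reduced_CK_family p s;
  Cmin_gen : cstar_gen (family_set p s) = setT;
  Cmin_neq0 : forall v, p v <> 0;
  Cmin_couniv : forall B (q : vertex E -> B) (t : edge E -> B),
    toeplitz_CK_family q t -> (forall v, q v <> 0) ->
    forall X, cutting_set X ->
    exists (kappa : edge E -> R[i]) (psi : B -> A),
      [/\ forall x, X x -> `|kappa x| = 1,
          star_hom_on (cstar_gen (family_set q t)) psi,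
          forall v, psi (q v) = p v,
          forall e, ~ X e -> psi (t e) = s e
        & forall x, X x -> psi (t x) = kappa x *: s x]
}.

End Families.

(* Main.v *)
Require Import Defs.
From mathcomp Require Import all_boot all_order all_algebra.
From mathcomp Require Import all_classical all_reals all_analysis.
From mathcomp Require Import complex.

Set Implicit Arguments.
Unset Strict Implicit.
Unset Printing Implicit Defensive.

Import Order.TTheory GRing.Theory Num.Theory.
Import numFieldNormedType.Exports.

Local Open Scope classical_set_scope.
Local Open Scope ring_scope.

(** Injectivity trivially keeps the nonzero vertex projections nonzero.

    Conversely, if no [phi (p v)] vanishes, the image of the canonical family is
    a Toeplitz-Cuntz-Krieger family with nonzero vertex projections.  Any cutting
    set [X] then gives, by co-universality, a *-homomorphism [psi] back to the
    co-universal algebra, which undoes [phi] on generators up to unimodular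
    scalars [kappa x] on the edges of [X].  These scalars are 1: the image family
    inherits the normalisation of entry-free cycles, and such a cycle contains
    exactly one edge of [X] ([cutting_set_scalars_trivial]).  So [psi \o phi] is
    the identity on generators, hence everywhere, and [phi] is injective
    ([star_hom_injective]).

    The last step needs automatic continuity of *-homomorphisms, proved here
    without spectral theory or unitization ([star_hom_contractive]).  If [h] is
    self-adjoint with [`|h| < 1], there is a self-adjoint [y] commuting with [h]
    such that [h^2 + (1 - y)^2 = 1]: it is a fixed point of the contraction
    [y |-> (h^2 + y^2) / 2] ([one_minus_square_root]).  The equation is algebraic,
    so it survives under a *-homomorphism [f]; and for commuting self-adjoint
    elements [b^2 + (1 - c)^2 = 1] forces [`|b| <= 1], because [b] is the average
    of the isometries [b + i(1 - c)] and [b - i(1 - c)]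
    ([norm_le1_of_sum_squares]).  Hence [`|f h| <= 1].

    Cutting sets exist because entry-free cycles sharing an edge have the same
    edges ([cutting_set_exists]). *)

(** * Fixed points of contractions over the complex numbers *)

Section ComplexScalars.
Context {R : realType}.
Implicit Types V W : normedModType R[i].

Lemma geometric_small (q e : R[i]) : 0 <= q < 1 -> 0 < e ->
  exists n, q ^+ n < e.
Proof.
move=> /andP[q0 q1] e0.
have qE : q = (complex.Re q)%:C%C by rewrite RRe_real// ger0_real.
have eE : e = (complex.Re e)%:C%C by rewrite RRe_real// gtr0_real.
move: q0 q1 e0; rewrite qE eE.
rewrite (ltcR (complex.Re q) 1) (ltcR 0 (complex.Re e)) ler0c => q0 q1 e0.
have nq : `|complex.Re q| < 1 by rewrite ger0_norm.
have /cvgrPdist_lt/(_ _ e0)[N _ /(_ N (leqnn N))] := cvg_geometric 1 nq.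
rewrite /= /geometric /= mul1r sub0r normrN ger0_norm ?exprn_ge0// => h.
by exists N; rewrite -rmorphXn ltcR.
Qed.

Lemma closed_norm_le V (K : R[i]) : closed [set x : V | `|x| <= K].
Proof.
move=> x clx; apply/ler_addgt0Pr => e e0.
have [y [/= yK]] := clx _ (nbhsx_ballx x _ e0).
rewrite -ball_normE /= => xy.
rewrite -(subrK y x) (le_trans (ler_normD _ _))// addrC lerD// ltW//.
Qed.

Lemma closed_zero_set (T : topologicalType) V (f : T -> V) :
  continuous f -> closed [set x | f x = 0].
Proof.
move=> /continuous_closedP/(_ [set x : V | `|x| <= 0] (@closed_norm_le _ _)).
by congr closed; apply/seteqP; split => x /=; rewrite normr_le0 => /eqP.
Qed.

Lemma additive_bounded_continuous V W (f : V -> W) (K : R[i]) : 0 < K ->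
  (forall x y, f (x - y) = f x - f y) -> (forall x, `|f x| <= K * `|x|) ->
  continuous f.
Proof.
move=> K0 fB fK x; apply/cvgrPdist_lt => e e0; near=> y.
rewrite -fB (le_lt_trans (fK _))// -ltr_pdivlMl//.
near: y; apply: cvgr_dist_lt; rewrite ?mulr_gt0 ?invr_gt0//; exact: cvg_id.
Unshelve. all: by end_near. Qed.

(** Banach's fixed-point theorem for complex scalars.  Boundedness of [U] gives
    the Cauchy estimate [`|T^(n+m) a - T^n a| <= 2K q^n] by induction on [n],
    without summing a geometric series. *)
Lemma bounded_contraction_fixed (V : completeNormedModType R[i]) (U : set V)
    (T : V -> V) (q K : R[i]) :
  0 <= q < 1 -> closed U -> U !=set0 -> (forall x, U x -> U (T x)) ->
  (forall x, U x -> `|x| <= K) ->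
  (forall x y, U x -> U y -> `|T x - T y| <= q * `|x - y|) ->
  exists2 y, U y & T y = y.
Proof.
move=> q01 clU [a Ua] TU UK Tq; have /andP[q0 q1] := q01.
pose u n := iter n T a.
have Uu n : U (u n) by elim: n => // n /TU.
have K0 : 0 <= K by apply: le_trans (UK _ Ua).
have dist n m : `|u n - u (n + m)%N| <= q ^+ n * (K + K).
  elim: n => [|n ih].
    by rewrite expr0 mul1r (le_trans (ler_normB _ _))// lerD// UK.
  by rewrite addSn exprS -mulrA (le_trans (Tq _ _ (Uu _) (Uu _)))// ler_wpM2l.
have K20 : 0 < K + K + 1 by rewrite ltr_wpDl// addr_ge0.
have tail e : 0 < e -> exists N, forall n, (N <= n)%N -> `|u N - u n| < e.
  move=> e0; have [|N hN] := geometric_small q01 (e := e / (K + K + 1)).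
    by rewrite divr_gt0.
  exists N => n /subnKC <-; apply: le_lt_trans (dist _ _) _.
  apply: (@le_lt_trans _ _ (q ^+ N * (K + K + 1))).
    by rewrite ler_wpM2l ?exprn_ge0// lerDl.
  by rewrite -ltr_pdivlMr.
have cu : cvg (u @ \oo).
  apply/cauchy_cvgP; apply/cauchy_exP => e e0.
  have [N hN] := tail e e0.
  by exists (u N); exists N => // n /hN /=; rewrite -ball_normE.
have /cvg_ex[l ul] := cu.
have Ul : U l by apply: (closed_cvg U) ul => //; exact: nearW.
exists l => //; apply/eqP; rewrite -subr_eq0 -normr_le0; apply/ler_addgt0Pr => e e0.
have e20 : 0 < e / 2 by rewrite divr_gt0.
have [N _ hN] : \forall n \near \oo, `|l - u n| < e / 2.
  by move/cvgrPdist_lt : ul; apply.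
have h1 := hN N (leqnn N); have h2 := hN N.+1 (leqnSn N).
rewrite add0r -(subrK (u N.+1) (T l)) -addrA (splitr e).
apply: le_trans (ler_normD _ _) _; apply: lerD; last by rewrite distrC ltW.
apply: le_trans (Tq _ _ Ul (Uu N)) _.
by apply: le_trans (ltW h1); rewrite ler_piMl// ltW.
Qed.

End ComplexScalars.

(** * Contractivity of *-homomorphisms *)

Section CStarAlgebra.
Context {R : realType}.
Implicit Types A B : cstarAlgType R.

Section Algebra.
Variable A : cstarAlgType R.
Implicit Types x y z u d w h b c : A.

Lemma amulNl x y : (- x) ** y = - (x ** y).
Proof. by rewrite -scaleN1r amulZl scaleN1r. Qed.

Lemma amulNr x y : x ** (- y) = - (x ** y).
Proof. by rewrite -scaleN1r amulZr scaleN1r. Qed.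

Lemma amulBl x y z : (x - y) ** z = x ** z - y ** z.
Proof. by rewrite amulDl amulNl. Qed.

Lemma amulBr x y z : x ** (y - z) = x ** y - x ** z.
Proof. by rewrite amulDr amulNr. Qed.

Lemma amul0l x : 0 ** x = 0.
Proof. by rewrite -(subrr 0) amulBl !subrr. Qed.

Lemma amul0r x : x ** 0 = 0.
Proof. by rewrite -(subrr 0) amulBr !subrr. Qed.

Lemma adjB x y : adj (x - y) = adj x - adj y.
Proof. by rewrite adjD -(scaleN1r y) Defs.adjZ rmorphN1 scaleN1r. Qed.

Lemma adj0 : adj (0 : A) = 0.
Proof. by rewrite -(subrr 0) adjB !subrr. Qed.

Lemma norm_adj x : `|adj x| = `|x|.
Proof.
suff le y : `|y| <= `|adj y|.
  by apply/eqP; rewrite eq_le le andbT -{2}(adjK x) le.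
have [->|y0] := eqVneq y 0; first by rewrite normr0.
by rewrite -(@ler_pM2r _ `|y|) ?normr_gt0// -expr2 -norm_cstar norm_amul.
Qed.

(** With [e = i] or [e = - i]: when the cross terms cancel, [u + i d] and
    [u - i d] have the same norm, computed from the sum of squares
    [adj u ** u + adj d ** d]. *)
Lemma adj_mul_imaginary (e : R[i]) u d : Num.conj e = - e -> e ^+ 2 = -1 ->
  adj u ** d = adj d ** u ->
  adj (u + e *: d) ** (u + e *: d) = adj u ** u + adj d ** d.
Proof.
move=> ec e2 ud.
rewrite adjD Defs.adjZ ec amulDr !amulDl !amulZr !amulZl ud !scaleNr scalerN.
by rewrite scalerA -expr2 e2 scaleN1r opprK addrA subrK.
Qed.

(** The last hypothesis is [b^2 + (1 - c)^2 = 1] with the unit cancelled.  It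
    makes left multiplication by [b + i(1 - c)] and by [b - i(1 - c)]
    isometric, and [b] is the average of these two elements. *)
Lemma norm_le1_of_sum_squares b c : adj b = b -> adj c = c ->
  c ** b = b ** c -> b ** b = c + c - c ** c -> `|b| <= 1.
Proof.
move=> sb sc cb bb.
(* [u + i d] is [(b + i(1 - c)) b]: testing the isometries on [b] itself turns
   [`|b ** b| <= `|b|] into the claim. *)
pose u := b ** b; pose d := b - c ** b.
have cross : adj u ** d = adj d ** u.
  rewrite /u /d adjB !adjM sb sc amulBr amulBl -!amulA.
  by rewrite (amulA c b) cb -(amulA b c) cb.
have sq : adj u ** u + adj d ** d = adj b ** b.
  have -> : adj u ** u = b ** (c ** b) + b ** (c ** b) - b ** (c ** (c ** b)).
    rewrite /u adjM sb -amulA (amulA b b b) bb.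
    by rewrite !(amulBl, amulDl, amulBr, amulDr) -!amulA.
  rewrite /d adjB adjM sb sc !(amulBl, amulBr) -!amulA opprB.
  set x := b ** (c ** b); set z := b ** (c ** (c ** b)).
  by rewrite addrC -addrA -(addrA x x) (addrA (z - x)) subrK (addrC z) !subrK.
have norm_m (e : R[i]) : Num.conj e = - e -> e ^+ 2 = -1 ->
    `|u + e *: d| = `|b|.
  move=> ec e2; apply/eqP; rewrite -(@eqrXn2 _ 2)// -!norm_cstar.
  by rewrite adj_mul_imaginary// sq.
have i2 := sqrCi R[i]; have ic := conjCi R[i].
have : `|u + u| <= `|b| + `|b|.
  rewrite -{1}(norm_m 'i)// -(norm_m (- 'i)) ?rmorphN/= ?ic ?sqrrN//.
  apply: le_trans (ler_normD _ _).
  by rewrite scaleNr addrACA subrr addr0.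
rewrite -!mulr2n normrMn lerMn2r/= /u -{1}sb norm_cstar.
have [->|b0] := eqVneq b 0; first by rewrite normr0 ler01.
by rewrite expr2 -{3}[ `|b| ]mulr1 ler_pM2l ?normr_gt0.
Qed.

(** The equation [(1 - y)^2 = 1 - h^2] is solved, without a unit, as the fixed
    point of [y |-> (h^2 + y^2) / 2].  On the ball of radius [q = `|h^2|] this
    map is a contraction of ratio [q], and it preserves the closed set of
    self-adjoint elements commuting with [h]. *)
Lemma one_minus_square_root h : adj h = h -> `|h| < 1 ->
  exists y, [/\ adj y = y, y ** h = h ** y & h ** h = y + y - y ** y].
Proof.
move=> sh h1.
pose q := `|h ** h|.
have hq : q = `|h| ^+ 2 by rewrite /q -{1}sh norm_cstar.
have q01 : 0 <= q < 1 by rewrite normr_ge0 hq expr_lt1.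
have /andP[q0 q1] := q01.
pose T y : A := 2^-1 *: (h ** h + y ** y).
pose U := [set y : A | adj y - y = 0] `&` [set y | y ** h - h ** y = 0]
  `&` [set y | `|y| <= q].
have half0 : 0 <= 2^-1 :> R[i] by rewrite invr_ge0.
have normhalf z : `|2^-1 *: z| = 2^-1 * `|z| by rewrite normrZ ger0_norm.
have clU : closed U.
  have cl1 : closed [set y : A | adj y - y = 0].
    apply: closed_zero_set; apply: (@additive_bounded_continuous _ _ _ _ 2) => // [x y|x].
      by rewrite adjB !opprB addrACA [RHS]addrACA [- adj y - _]addrC.
    by rewrite mulr_natl mulr2n (le_trans (ler_normB _ _))// norm_adj.
  have cl2 : closed [set y : A | y ** h - h ** y = 0].
    apply: closed_zero_set.
    apply: (@additive_bounded_continuous _ _ _ _ (`|h| + `|h| + 1)).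
    - by rewrite ltr_wpDl// addr_ge0.
    - move=> x y; rewrite amulBl amulBr !opprB.
      by rewrite addrACA [RHS]addrACA [- (y ** h) - _]addrC.
    - move=> x; rewrite (le_trans (ler_normB _ _))//.
      rewrite !mulrDl mul1r -[leLHS]addr0 lerD// lerD//.
        by rewrite mulrC norm_amul.
      exact: norm_amul.
  exact: closedI (closedI cl1 cl2) (@closed_norm_le _ A q).
have U0 : U 0.
  by rewrite /U/= adj0 subrr amul0l amul0r subrr normr0.
have TU x : U x -> U (T x).
  move=> [[/subr0_eq sx /subr0_eq xh] xq]; rewrite /T; split; [split|] => /=.
  - by rewrite Defs.adjZ adjD !adjM sh sx fmorphV rmorph_nat subrr.
  - rewrite amulZl amulZr amulDl amulDr !amulA -!(amulA x) xh !amulA xh.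
    by rewrite subrr.
  - rewrite normhalf ler_pdivrMl// mulr_natl mulr2n.
    rewrite (le_trans (ler_normD _ _))// lerD// (le_trans (norm_amul _ _))//.
    by rewrite -[leRHS]mulr1 ler_pM// (le_trans xq)// ltW.
have [|||y [[/subr0_eq sy /subr0_eq yh] _] Ty] :=
  bounded_contraction_fixed q01 clU _ TU (K := q).
- by exists 0.
- by move=> x [].
- move=> x z [_ xq] [_ zq].
  rewrite /T -scalerBr normhalf ler_pdivrMl// opprD addrACA subrr add0r.
  have -> : x ** x - z ** z = x ** (x - z) + (x - z) ** z.
    by rewrite amulBr amulBl addrA subrK.
  apply: le_trans (ler_normD _ _) _; rewrite mulr_natl mulr2n lerD//.
    by apply: le_trans (norm_amul _ _) _; rewrite ler_wpM2r.
  by apply: le_trans (norm_amul _ _) _; rewrite mulrC ler_wpM2r.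
exists y; split => //; apply/eqP; rewrite eq_sym subr_eq; apply/eqP.
rewrite -{1 2}Ty /T -scalerDl -mulr2n -[_ *+ 2]mulr_natr mulVf ?pnatr_eq0//.
by rewrite scale1r.
Qed.

End Algebra.

Section StarHom.
Variables (A B : cstarAlgType R) (f : A -> B).
Hypothesis f_hom : star_hom f.

Let fD x y : f (x + y) = f x + f y. Proof. exact: (homD f_hom). Qed.
Let fZ (c : R[i]) x : f (c *: x) = c *: f x. Proof. exact: (homZ f_hom). Qed.
Let fM x y : f (x ** y) = f x ** f y. Proof. exact: (homM f_hom). Qed.
Let fadj x : f (adj x) = adj (f x). Proof. exact: (hom_adj f_hom). Qed.

Lemma star_hom0 : f 0 = 0.
Proof. by rewrite -(scale0r 0) fZ scale0r. Qed.

Lemma star_homB x y : f (x - y) = f x - f y.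
Proof. by rewrite fD -(scaleN1r y) fZ scaleN1r. Qed.

(** By the C*-identity it is enough to treat [h = adj x ** x], where the
    equation [h^2 + (1 - y)^2 = 1] is transported by [f]. *)
Lemma star_hom_ball x : `|x| < 1 -> `|f x| <= 1.
Proof.
move=> x1; rewrite -(@expr_le1 _ 2)// -norm_cstar -fadj -fM.
set h := adj x ** x.
have sh : adj h = h by rewrite /h adjM adjK.
have h1 : `|h| < 1 by rewrite /h norm_cstar expr_lt1.
have [y [sy yh hh]] := one_minus_square_root sh h1.
apply: (@norm_le1_of_sum_squares _ _ (f y)); rewrite -?fadj -?fM ?sh ?sy ?yh//.
by rewrite hh star_homB fD fM.
Qed.

(** Only the scaling is left: [x / (`|x| + e)] lies in the open unit ball for
    every [e > 0]. *)
Lemma star_hom_contractive x : `|f x| <= `|x|.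
Proof.
apply/ler_addgt0Pr => e e0.
have r0 : 0 < `|x| + e by rewrite ltr_wpDl.
have nr z : `|(`|x| + e)^-1 *: z| = `|z| / (`|x| + e) :> R[i].
  by rewrite normrZ gtr0_norm ?invr_gt0// mulrC.
have nr' (z : B) : `|(`|x| + e)^-1 *: z| = `|z| / (`|x| + e) :> R[i].
  by rewrite normrZ gtr0_norm ?invr_gt0// mulrC.
rewrite -[leRHS]mul1r -ler_pdivrMr// -nr' -fZ star_hom_ball// nr.
by rewrite ltr_pdivrMr// mul1r ltrDl.
Qed.

Lemma star_hom_continuous : continuous f.
Proof.
apply: (@additive_bounded_continuous _ _ _ _ 1) => //; first exact: star_homB.
by move=> x; rewrite mul1r star_hom_contractive.
Qed.

Lemma star_hom_cle x y : cle x y -> cle (f x) (f y).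
Proof. by move=> [z xy]; exists (f z); rewrite -star_homB xy fM fadj. Qed.

Lemma star_hom_fsum (I : choiceType) (F : set I) (g : I -> A) : finite_set F ->
  f (\sum_(i \in F) g i) = \sum_(i \in F) f (g i).
Proof.
move=> finF; rewrite !fsbig_finite//.
by rewrite (big_morph f fD star_hom0).
Qed.

End StarHom.

Lemma cstar_gen_subalgebra A (G : set A) : cstar_subalgebra (cstar_gen G).
Proof.
split.
- by move=> M [/csub0].
- by move=> x y Sx Sy M MG; apply: (csubD MG.1); [exact: Sx|exact: Sy].
- by move=> c x Sx M MG; apply: (csubZ MG.1); exact: Sx.
- by move=> x y Sx Sy M MG; apply: (csubM MG.1); [exact: Sx|exact: Sy].
- by move=> x Sx M MG; apply: (csub_adj MG.1); exact: Sx.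
- by apply: closed_bigI => M [/csub_closed].
Qed.

Lemma star_hom_preimage A B (f : A -> B) (S : set B) :
  star_hom f -> cstar_subalgebra S -> cstar_subalgebra (f @^-1` S).
Proof.
move=> f_hom subS; split => /=.
- by rewrite star_hom0//; exact: csub0.
- by move=> x y Sx Sy; rewrite (homD f_hom)//; exact: csubD.
- by move=> c x Sx; rewrite (homZ f_hom)//; exact: csubZ.
- by move=> x y Sx Sy; rewrite (homM f_hom)//; exact: csubM.
- by move=> x Sx; rewrite (hom_adj f_hom)//; exact: csub_adj.
- apply: (continuous_closedP _).1; last exact: csub_closed.
  exact: star_hom_continuous.
Qed.

Lemma star_hom_fixed_points A (f : A -> A) :
  star_hom f -> cstar_subalgebra [set x | f x = x].
Proof.
move=> f_hom; split => /=.
- exact: star_hom0.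
- by move=> x y fx fy; rewrite (homD f_hom)// fx fy.
- by move=> c x fx; rewrite (homZ f_hom)// fx.
- by move=> x y fx fy; rewrite (homM f_hom)// fx fy.
- by move=> x fx; rewrite (hom_adj f_hom)// fx.
- have -> : [set x | f x = x] = [set x | f x - x = 0].
    by apply/seteqP; split => x /= => [->|/subr0_eq//]; rewrite subrr.
  apply: closed_zero_set => x; apply: cvgB; last exact: cvg_id.
  exact: star_hom_continuous.
Qed.

Lemma star_hom_comp A B (f : A -> B) (g : B -> A) (S : set B) :
  star_hom f -> (forall x, S (f x)) -> star_hom_on S g -> star_hom (g \o f).
Proof.
move=> f_hom Sf g_hom; split => /=.
- by move=> x y _ _; rewrite (homD f_hom)// (homD g_hom).
- by move=> c x _; rewrite (homZ f_hom)// (homZ g_hom).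
- by move=> x y _ _; rewrite (homM f_hom)// (homM g_hom).
- by move=> x _; rewrite (hom_adj f_hom)// (hom_adj g_hom).
Qed.

(** Both steps extend a property from generators by continuity: [f] maps into
    the domain of [g], because [f] is continuous; then [g \o f] is a
    *-homomorphism defined everywhere, so it is continuous too and its fixed
    points form a C*-subalgebra. *)
Lemma star_hom_injective A B (f : A -> B) (g : B -> A) (G : set A) (H : set B) :
  star_hom f -> cstar_gen G = setT -> (forall x, G x -> H (f x)) ->
  star_hom_on (cstar_gen H) g -> (forall x, G x -> g (f x) = x) ->
  injective f.
Proof.
move=> f_hom genG GH g_hom gf.
have Sf x : cstar_gen H (f x).
  have : cstar_gen G `<=` f @^-1` cstar_gen H.
    apply: smallest_sub => [|y Gy].
      exact: star_hom_preimage f_hom (cstar_gen_subalgebra _).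
    by apply: sub_gen_smallest; exact: GH.
  by rewrite genG; exact.
have gfK : cancel f g.
  move=> x; have : cstar_gen G `<=` [set y | (g \o f) y = y].
    apply: smallest_sub => [|y Gy]; last exact: gf.
    exact: star_hom_fixed_points (star_hom_comp f_hom Sf g_hom).
  by rewrite genG; exact.
exact: can_inj gfK.
Qed.

End CStarAlgebra.

(** * Cycles without entrance *)

Section Cycles.
Variable E : digraph.
Implicit Types (e f x : edge E) (mu nu : seq (edge E)).

Lemma is_cycleE mu : is_cycle mu =
  [&& mu != [::], cycle (@composable E) mu & uniq (map (@src E) mu)].
Proof.
case: mu => // e mu.
rewrite /is_cycle /cycle rcons_path /= [composable (last _ _) _]eq_sym.
by rewrite !andbA.
Qed.

Lemma is_cycle_rot n mu : is_cycle (rot n mu) = is_cycle mu.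
Proof. by rewrite !is_cycleE -!size_eq0 size_rot rot_cycle map_rot rot_uniq. Qed.

Lemma no_entrance_rot n mu : no_entrance (rot n mu) <-> no_entrance mu.
Proof. by split=> h f; have := h f; rewrite mem_rot. Qed.

Lemma class_edges_cycle mu : class_edges (cycle_class mu) = [set` mu].
Proof.
apply/seteqP; split => [e [_ [k ->]]|e emu] /=; first by rewrite mem_rot.
by exists mu => //; exists 0%N; rewrite rot0.
Qed.

(** Along a path each new edge points to the source of the previous one.  If
    the previous one lies on an entry-free cycle, the edge of the cycle with
    that range is the only candidate for the new edge. *)
Lemma path_stays_in_cycle nu f mu : is_cycle nu -> no_entrance nu -> f \in nu ->
  path (@composable E) f mu -> {subset mu <= nu}.
Proof.
rewrite is_cycleE => /and3P[_ cnu _] nnu; elim: mu f => // g mu ih f fnu /=.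
move=> /andP[/eqP fg gmu].
have gnu : g \in nu.
  have := next_cycle cnu fnu; rewrite /composable fg => /eqP rg.
  have nnu' : next nu f \in nu by rewrite mem_next.
  by rewrite (nnu _ nnu' g).
by move=> e; rewrite inE => /orP[/eqP->//|]; apply: ih gmu e.
Qed.

Lemma cycle_from mu e : is_cycle mu -> e \in mu ->
  exists mu', [/\ is_cycle (e :: mu'), e :: mu' =i mu
                & no_entrance mu -> no_entrance (e :: mu')].
Proof.
move=> cmu /rot_to[n mu' rotmu]; exists mu'; rewrite -rotmu is_cycle_rot.
by split=> //; [exact: mem_rot|move=> /no_entrance_rot; exact].
Qed.

Lemma entry_free_cycles_meet mu nu e : is_cycle mu -> is_cycle nu ->
  no_entrance nu -> e \in mu -> e \in nu -> {subset mu <= nu}.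
Proof.
move=> cmu cnu nnu emu enu; have [mu' [cmu' eqmu _]] := cycle_from cmu emu.
move=> f; rewrite -eqmu inE => /orP[/eqP->//|].
by case/and3P: cmu' => pmu' _ _; apply: path_stays_in_cycle pmu' f.
Qed.

Lemma entry_free_classes_edges (C D : set (seq (edge E))) e :
  entry_free_classes C -> entry_free_classes D ->
  class_edges C e -> class_edges D e -> class_edges C = class_edges D.
Proof.
move=> [mu [cmu nmu ->]] [nu [cnu nnu ->]]; rewrite !class_edges_cycle /=.
move=> emu enu; apply/seteqP; split => f /=.
- exact: entry_free_cycles_meet emu enu f.
- exact: entry_free_cycles_meet enu emu f.
Qed.

(** The chosen edge depends only on the set of edges of the class, and two such
    sets coincide or are disjoint; hence no class receives two edges. *)
Lemma cutting_set_exists : exists X : set (edge E), cutting_set X.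
Proof.
have [[e0]|noedge] := pselect (inhabited (edge E)); last first.
  exists set0; split => // C [[|e mu] [//]].
  by case: noedge; constructor.
pose rep (C : set (seq (edge E))) := xget e0 (class_edges C).
have repP C : entry_free_classes C -> class_edges C (rep C).
  move=> [[|e mu] [// _ _ ->]]; apply: xgetPex; exists e.
  by rewrite class_edges_cycle /= mem_head.
exists (rep @` @entry_free_classes E); split.
  by move=> _ [C EC <-]; exists C => //; exact: repP.
move=> C EC; exists (rep C); apply/seteqP; split => [_ [[D ED <-] CD]|_ ->] /=.
  by rewrite /rep (entry_free_classes_edges ED EC (repP _ ED) CD).
by split; [exists C|exact: repP].
Qed.

Lemma cutting_set_cycle (X : set (edge E)) x : cutting_set X -> X x ->
  exists mu, [/\ is_cycle (x :: mu), no_entrance (x :: mu)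
              & forall e, e \in mu -> ~ X e].
Proof.
move=> [XC Xsing] Xx; have [C EC Cx] := XC x Xx.
have [y XCy] := Xsing _ EC.
case: EC XCy Cx => mu [cmu nmu ->]; rewrite class_edges_cycle /= => XCy xmu.
have [mu' [cmu' eqmu nmu']] := cycle_from cmu xmu.
exists mu'; split => //; first exact: nmu'.
move=> e emu' Xe; have inj f : f \in mu -> X f -> f = y.
  by move=> fmu Xf; have : [set y] f by rewrite -XCy.
have ex : e = x by rewrite (inj x)// (inj e)// -eqmu inE emu' orbT.
by case/and3P: cmu' => _ _ /= /andP[/mapP[]]; exists e; rewrite // ex.
Qed.

End Cycles.

(** * Families in C*-algebras *)

Section Families.
Context {R : realType} (E : digraph).
Implicit Types A B : cstarAlgType R.

Section Image.
Variables (A B : cstarAlgType R) (f : A -> B).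
Hypothesis f_hom : star_hom f.
Variables (p : vertex E -> A) (s : edge E -> A).

Lemma toeplitz_CK_family_image :
  toeplitz_CK_family p s -> toeplitz_CK_family (f \o p) (f \o s).
Proof.
move=> [pp po ss sr]; split => /=.
- by move=> v; have [a b] := pp v; rewrite /projection -(hom_adj f_hom)// -(homM f_hom)// a b.
- by move=> v w vw; rewrite -(homM f_hom)// po//; exact: star_hom0.
- by move=> e; rewrite -(hom_adj f_hom)// -(homM f_hom)// ss.
- move=> v F finF Fv.
  rewrite (_ : (\sum_(e \in F) _) = f (\sum_(e \in F) s e ** adj (s e))).
    exact: star_hom_cle (sr _ _ finF Fv).
  rewrite star_hom_fsum//; apply: eq_fsbigr => e _.
  by rewrite (homM f_hom)// (hom_adj f_hom).
Qed.

Lemma path_elt_image e mu : path_elt (f \o s) e mu = f (path_elt s e mu).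
Proof.
rewrite /path_elt /=; elim/last_ind: mu => // mu g ih.
by rewrite !foldl_rcons ih (homM f_hom).
Qed.

End Image.

(** If a *-homomorphism carries one normalised family to another up to scalars
    supported on a cutting set, the scalars are trivial: each marked edge lies
    on an entry-free cycle whose other edges are unmarked, and the normalisation
    of that cycle reads [p = kappa x *: p]. *)
Lemma cutting_set_scalars_trivial A B (p : vertex E -> A) (s : edge E -> A)
    (q : vertex E -> B) (t : edge E -> B) (S : set B) (g : B -> A)
    (X : set (edge E)) (kappa : edge E -> R[i]) :
  normalised_reduced_CK_family p s -> (forall v, p v <> 0) ->
  (forall e mu, is_cycle (e :: mu) -> no_entrance (e :: mu) ->
     path_elt t e mu = q (rng e)) ->
  cstar_subalgebra S -> (forall e, S (t e)) -> star_hom_on S g ->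
  cutting_set X ->
  (forall v, g (q v) = p v) -> (forall e, ~ X e -> g (t e) = s e) ->
  (forall x, X x -> g (t x) = kappa x *: s x) ->
  forall x, X x -> kappa x = 1.
Proof.
move=> [_ nps] p0 nqt subS St g_hom cutX gq gt gx x Xx.
have [mu [cmu nmu muX]] := cutting_set_cycle cutX Xx.
have [_] : S (path_elt t x mu) /\ g (path_elt t x mu) = kappa x *: path_elt s x mu.
  elim/last_ind: mu muX {cmu nmu} => [|mu f ih] muX.
    by split; [exact: St|exact: gx].
  have [|Smu gmu] := ih.
    by move=> e emu; apply: muX; rewrite mem_rcons inE emu orbT.
  rewrite /path_elt !foldl_rcons; split; first exact: (csubM subS Smu (St f)).
  rewrite (homM g_hom)// gmu gt ?amulZl//.
  by apply: muX; rewrite mem_rcons mem_head.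
rewrite nqt// nps// gq -[LHS]scale1r => /eqP.
rewrite -subr_eq0 -scalerBl scaler_eq0 subr_eq0 => /orP[/eqP->//|/eqP].
by move=> /p0.
Qed.

End Families.

Theorem corollary4p3 (R : realType) (E : digraph) (E_row_finite : row_finite E)
    (Cmin : cstarAlgType R) (p : vertex E -> Cmin) (s : edge E -> Cmin)
    (Cmin_couniversal : is_Cmin p s)
    (B : cstarAlgType R) (phi : Cmin -> B) (phi_hom : star_hom phi) :
  injective phi <-> forall v : vertex E, phi (p v) <> 0.
Proof.
have [ps genps p0 couniv] := Cmin_couniversal.
split=> [phi_inj v|phi_p].
  by rewrite -(star_hom0 phi_hom) => /phi_inj; exact: p0.
have [X cutX] := cutting_set_exists E.
have [kappa [psi [k1 psi_hom psi_p psi_s psi_x]]] :=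
  couniv B _ _ (toeplitz_CK_family_image phi_hom ps.1.1) phi_p X cutX.
have kappa1 x : X x -> kappa x = 1.
  apply: (cutting_set_scalars_trivial ps p0 _ (cstar_gen_subalgebra _) _ psi_hom
    cutX psi_p psi_s psi_x).
  - by move=> e mu cmu nmu; rewrite path_elt_image// ps.2.
  - by move=> e; apply: sub_gen_smallest; right; exists e.
apply: star_hom_injective phi_hom genps _ psi_hom _.
- by move=> _ [[v _ <-]|[e _ <-]]; [left; exists v|right; exists e].
- move=> _ [[v _ <-]|[e _ <-]]; first exact: psi_p.
  have [Xe|nXe] := pselect (X e); last exact: psi_s.
  by have := psi_x e Xe; rewrite kappa1// scale1r.
Qed.
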